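(* Let $f:\mathbb R^n\to\mathbb R\cup\{+\infty\}$ be proper and lower semicontinuous, and for every $\bar x\in\operatorname{dom} f$ let $f_{\bar x}$ be a local model function for $f$ around $\bar x$. Assume: (a) $f$ is bounded from below; (b) for every $\bar x\in\operatorname{dom} f$, $f_{\bar x}$ is bounded from below by an affine function; (c) $H:\mathbb R^n\to\mathbb R^{n\times n}_{\ge\mu}$ is continuous; (d) $x^*\in\mathbb R^n$ is an accumulation point of the sequence $(x^k)_{k\in\mathbb N}$ generated by the Model Proximal Quasi-Newton Method; (e) for all $\bar x\in\operatorname{dom} f$ the function $g_{\bar x}:=f_{\bar x}-f$ is smooth, and there is a constant $L>0$ such that for all $\bar x\in\operatorname{dom} f$ and all $x$, $\partial g_{\bar x}(x)\subset L\,B_{\|x-\bar x\|}(0)$ (that is, $\|\nabla g_{\bar x}(x)\|\le L\|x-\bar x\|$); (f) $f$ has the KL property at $x^*$. Then the whole sequence $(x^k)_{k\in\mathbb N}$ converges to $x^*$, and $x^*$ is a stationary point of $f$, i.e. $0\in\partial f(x^* )$.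
   Context: **Subdifferentials.** For $h:\mathbb R^n\to\mathbb R\cup\{+\infty\}$ and $\bar x\in\operatorname{dom}h=\{x: h(x)<\infty\}$, the regular subdifferential $\hat\partial h(\bar x)$ is the set of $v$ with $\liminf_{x\to\bar x,\,x\ne\bar x}\frac{h(x)-h(\bar x)-\langle v,x-\bar x\rangle}{\|x-\bar x\|}\ge 0$. The (limiting) subdifferential $\partial h(\bar x)$ is the set of $v$ for which there are $x^k\to\bar x$ with $h(x^k)\to h(\bar x)$ and $v^k\in\hat\partial h(x^k)$ with $v^k\to v$. Both are empty for $\bar x\notin\operatorname{dom}h$. A point $x\in\operatorname{dom}h$ is stationary for $h$ if $0\in\partial h(x)$. **KL property.** A proper lower semicontinuous $g:\mathbb R^n\to\mathbb R\cup\{+\infty\}$ has the KL (Kurdyka-Łojasiewicz) property at $x^*\in\operatorname{dom}\partial g$ (i.e. $\partial g(x^* )\neq\emptyset$) if there exist $\eta>0$, a neighborhood $U$ of $x^*$ and a continuous concave function $\varphi:[0,\eta]\to\mathbb R_+$ with $\varphi(0)=0$, $\varphi\in C^1(0,\eta)$, $\varphi'(t)>0$ for all $t\in(0,\eta)$, such that $\varphi'(g(x)-g(x^* ))\,\operatorname{dist}(0,\partial g(x))\ge1$ for all $x\in U$ with $g(x^* )<g(x)<g(x^* )+\eta$. **Model functions.** A growth function is a differentiable $\omega:\mathbb R_+\to\mathbb R_+$ with $\omega(0)=\omega'_+(0)=0$ (right derivative). A local model function for $f$ around $\bar x\in\operatorname{dom}f$ is a proper lower semicontinuous $f_{\bar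 x}:\mathbb R^n\to\mathbb R\cup\{+\infty\}$ with $\operatorname{dom}f_{\bar x}=\operatorname{dom}f$ for which there is a growth function $\omega_{\bar x}$ (depending on $\bar x$) with $|f(x)-f_{\bar x}(x)|\le\omega_{\bar x}(\|x-\bar x\|)$ for all $x\in\operatorname{dom} f$ in some neighborhood of $\bar x$. The function $g_{\bar x}$ is regarded as a real-valued function on $\mathbb R^n$ that equals $f_{\bar x}-f$ on $\operatorname{dom}f$, so that $f_{\bar x}=g_{\bar x}+f$; ''smooth'' means continuously differentiable on $\mathbb R^n$. **Notation.** $B_r(z)$ is the closed ball of radius $r\geq 0$ centered at $z$. $\mathbb R^{n\times n}_{\ge\mu}$ is the set of symmetric $n\times n$ matrices with smallest eigenvalue $\ge\mu$. For positive definite $A$, $\|v\|_A=\sqrt{\langle Av,v\rangle}$. **Model Proximal Quasi-Newton Method.** Parameters: $\tau>1$, $\mu>0$, $0<\gamma_{\min}\le\gamma_{\max}<\infty$, $\delta\in(0,\tfrac12)$, $H:\mathbb R^n\to\mathbb R^{n\times n}_{\ge\mu}$ continuous. Start with $x^0\in\operatorname{dom}f$. For $k=0,1,2,\dots$, as long as $x^k$ is not a stationary point of $f$: choose $\gamma_k^0\in[\gamma_{\min},\gamma_{\max}]$ and set $H_k:=H(x^k)$; for $i=0,1,2,\dots$ put $\gamma_{k,i}:=\tau^{i+1}\gamma_k^0$ and compute a (global) solution $x^{k,i}$ of $\min_x f_{x^k}(x)+\frac{\gamma_{k,i}}2\|x-x^k\|_{H_k}^2$, until $|f(x^{k,i})-f_{x^k}(x^{k,i})|\le\delta\frac{\gamma_{k,i}}2\|x^{k,i}-x^k\|_{H_k}^2$;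 with $i_k$ the terminal value of $i$, set $\gamma_k:=\gamma_{k,i_k}$ and $x^{k+1}:=x^{k,i_k}$. The generated sequence $(x^k)_{k\in\mathbb N}$ is understood to be infinite. *)

(* Defs.v *)
From HB Require Import structures.
From mathcomp Require Import all_boot all_order all_algebra.
From mathcomp Require Import all_classical all_reals all_analysis.

Set Implicit Arguments.
Unset Strict Implicit.
Unset Printing Implicit Defensive.

Import Order.TTheory GRing.Theory Num.Theory.
Import numFieldNormedType.Exports.

Local Open Scope classical_set_scope.
Local Open Scope ring_scope.

(* R^n is 'rV[R]_n with its library topology. The library norm `|x| on 'rV[R]_n
   is the sup norm, so the Euclidean norm is introduced separately. *)

Definition dot (R : realType) (n : nat) (u v : 'rV[R]_n) : R :=
  \sum_(i < n) u 0 i * v 0 i.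

Definition enorm (R : realType) (n : nat) (v : 'rV[R]_n) : R :=
  Num.sqrt (dot v v).

Definition ecball (R : realType) (n : nat) (r : R) (z : 'rV[R]_n) :
    set 'rV[R]_n :=
  [set y | enorm (y - z) <= r].

(* v *m A^T is the row vector representing the column vector A v. *)
Definition mnorm (R : realType) (n : nat) (A : 'M[R]_n) (v : 'rV[R]_n) : R :=
  Num.sqrt (dot (v *m A^T) v).

Definition sym_eig_ge (R : realType) (n : nat) (mu : R) : set 'M[R]_n :=
  [set A | A^T = A /\ forall a : R, eigenvalue A a -> mu <= a].

Definition edom (R : realType) (n : nat) (h : 'rV[R]_n -> \bar R) :
    set 'rV[R]_n :=
  [set x | (h x < +oo)%E].

Definition proper_fun (R : realType) (n : nat) (h : 'rV[R]_n -> \bar R) : Prop :=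
  (forall x, h x != -oo%E) /\ exists x, edom h x.

Definition regular_subdiff (R : realType) (n : nat) (h : 'rV[R]_n -> \bar R)
    (xb : 'rV[R]_n) : set 'rV[R]_n :=
  [set v | edom h xb /\
    (0 <= limf_einf
      (fun x => (h x - h xb - (dot v (x - xb))%:E) * ((enorm (x - xb))^-1)%:E)
      xb^')%E].

Definition subdiff (R : realType) (n : nat) (h : 'rV[R]_n -> \bar R)
    (xb : 'rV[R]_n) : set 'rV[R]_n :=
  [set v | edom h xb /\
    exists (x : nat -> 'rV[R]_n) (w : nat -> 'rV[R]_n),
      [/\ x @ \oo --> xb,
          h (x k) @[k --> \oo] --> h xb,
          forall k, regular_subdiff h (x k) (w k) &
          w @ \oo --> v]].

Definition stationary (R : realType) (n : nat) (h : 'rV[R]_n -> \bar R)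
    (x : 'rV[R]_n) : Prop :=
  edom h x /\ subdiff h x 0.

(* Equal to +oo when S is empty. *)
Definition dist_set (R : realType) (n : nat) (z : 'rV[R]_n) (S : set 'rV[R]_n) :
    \bar R :=
  ereal_inf [set (enorm (z - v))%:E | v in S].

Definition concave_on (R : realType) (D : set R) (phi : R -> R) : Prop :=
  forall s t l : R, D s -> D t -> 0 <= l <= 1 ->
    l * phi s + (1 - l) * phi t <= phi (l * s + (1 - l) * t).

(* phi : [0, eta] -> R_+ is represented by a total function of which only the
   restriction to [0, eta] is constrained. *)
Definition desingularizing (R : realType) (eta : R) (phi : R -> R) : Prop :=
  [/\ {within `[0, eta], continuous phi},
      concave_on `[0, eta] phi,
      (forall t : R, t \in `[0, eta] -> 0 <= phi t),
      phi 0 = 0 &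
      forall t : R, t \in `]0, eta[ ->
        [/\ derivable phi t 1, {for t, continuous (derive1 phi)} & 0 < derive1 phi t]].

Definition KL_property (R : realType) (n : nat) (g : 'rV[R]_n -> \bar R)
    (xs : 'rV[R]_n) : Prop :=
  [/\ proper_fun g, lower_semicontinuous g, subdiff g xs !=set0 &
   exists (eta : R) (U : set 'rV[R]_n) (phi : R -> R),
     [/\ 0 < eta, nbhs xs U, desingularizing eta phi &
      forall x, U x -> (g xs < g x)%E -> (g x < g xs + eta%:E)%E ->
        (1 <= (derive1 phi (fine (g x - g xs)))%:E * dist_set 0 (subdiff g x))%E]].

(* Differentiability on R_+ is two-sided on ]0, +oo[ and one-sided at 0. *)
Definition growth_function (R : realType) (w : R -> R) : Prop :=
  [/\ (forall t : R, 0 <= t -> 0 <= w t),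
      (forall t : R, 0 < t -> derivable w t 1),
      w 0 = 0 &
      (w t - w 0) / t @[t --> 0^'+] --> (0 : R)].

Definition local_model (R : realType) (n : nat) (f : 'rV[R]_n -> \bar R)
    (xb : 'rV[R]_n) (m : 'rV[R]_n -> \bar R) : Prop :=
  [/\ proper_fun m, lower_semicontinuous m, edom m = edom f &
   exists2 w : R -> R, growth_function w &
     \forall x \near xb, edom f x ->
       (`|f x - m x| <= (w (enorm (x - xb)))%:E)%E].

Definition bounded_below (R : realType) (n : nat) (h : 'rV[R]_n -> \bar R) :
    Prop :=
  exists c : R, forall x, (c%:E <= h x)%E.

Definition affinely_minorized (R : realType) (n : nat)
    (h : 'rV[R]_n -> \bar R) : Prop :=
  exists (a : 'rV[R]_n) (b : R), forall x, ((dot a x + b)%:E <= h x)%E.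

Definition gradient (R : realType) (n : nat) (g : 'rV[R]_n -> R)
    (x : 'rV[R]_n) : 'rV[R]_n :=
  \row_(i < n) 'd g x (delta_mx 0 i).

Definition smooth (R : realType) (n : nat) (g : 'rV[R]_n -> R) : Prop :=
  (forall x : 'rV[R]_n, differentiable g x) /\ continuous (gradient g).

Definition global_min (R : realType) (n : nat) (h : 'rV[R]_n -> \bar R)
    (z : 'rV[R]_n) : Prop :=
  forall y, (h z <= h y)%E.

Definition subproblem (R : realType) (n : nat) (m : 'rV[R]_n -> \bar R)
    (A : 'M[R]_n) (gam : R) (xk : 'rV[R]_n) (y : 'rV[R]_n) : \bar R :=
  (m y + (gam / 2 * mnorm A (y - xk) ^+ 2)%:E)%E.

Definition acceptable (R : realType) (n : nat) (f m : 'rV[R]_n -> \bar R)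
    (A : 'M[R]_n) (delta gam : R) (xk : 'rV[R]_n) (y : 'rV[R]_n) : Prop :=
  (`|f y - m y| <= (delta * (gam / 2) * mnorm A (y - xk) ^+ 2)%:E)%E.

(* One outer iteration from xk to xk1: g0 is the initial stepsize, y i the
   i-th trial point and ik the terminal inner index. *)
Definition mpqn_step (R : realType) (n : nat) (f : 'rV[R]_n -> \bar R)
    (F : 'rV[R]_n -> 'rV[R]_n -> \bar R) (H : 'rV[R]_n -> 'M[R]_n)
    (tau gmin gmax delta : R) (xk xk1 : 'rV[R]_n) : Prop :=
  exists (g0 : R) (y : nat -> 'rV[R]_n) (ik : nat),
    let gam := fun i : nat => tau ^+ i.+1 * g0 in
    [/\ gmin <= g0 <= gmax,
        (forall i, (i <= ik)%N ->
          global_min (subproblem (F xk) (H xk) (gam i) xk) (y i)),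
        (forall i, (i < ik)%N ->
          ~ acceptable f (F xk) (H xk) delta (gam i) xk (y i)),
        acceptable f (F xk) (H xk) delta (gam ik) xk (y ik) &
        xk1 = y ik].

(* The infinite sequences generated by the method: as it stops at a stationary
   point, no iterate of an infinite run is stationary. *)
Definition mpqn_sequence (R : realType) (n : nat) (f : 'rV[R]_n -> \bar R)
    (F : 'rV[R]_n -> 'rV[R]_n -> \bar R) (H : 'rV[R]_n -> 'M[R]_n)
    (tau gmin gmax delta : R) (x : nat -> 'rV[R]_n) : Prop :=
  edom f (x 0%N) /\
  forall k, ~ stationary f (x k) /\
    mpqn_step f F H tau gmin gmax delta (x k) (x k.+1).

(* Main.v *)
Require Import Defs.
From HB Require Import structures.
From mathcomp Require Import all_boot all_order all_algebra.
From mathcomp Require Import all_classical all_reals all_analysis.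
From mathcomp Require Import ring lra.

Set Implicit Arguments.
Unset Strict Implicit.
Unset Printing Implicit Defensive.

Import Order.TTheory GRing.Theory Num.Theory.
Import numFieldNormedType.Exports.

Local Open Scope classical_set_scope.
Local Open Scope ring_scope.

(* The gradient bound gives [|g u z| <= L |z - u|^2], so a trial point is
   accepted as soon as its stepsize reaches [2 L / (delta mu)], and the accepted
   stepsizes are bounded. Minimality together with the acceptance test then
   yields the decrease [f (x (k+1)) + a |x (k+1) - x k|^2 <= f (x k)], and
   Fermat's rule a subgradient of [f] at [x (k+1)] of norm at most
   [B |x (k+1) - x k|] as long as [x k] is close enough to [xs] for [H] to be
   bounded. Comparing the subproblem values at [x (k+1)] and at [xs] shows that
   [f (x k)] tends to [f xs]. By the KL inequality the step lengths are then
   dominated by the decrease of [phi (f (x k) - f xs)], which traps the iterates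
   near [xs]. *)

Section DotProduct.
Context {R : realType} {n : nat}.
Implicit Types (u v w : 'rV[R]_n) (A : 'M[R]_n).

Lemma dotC u v : dot u v = dot v u.
Proof. by apply: eq_bigr => i _; rewrite mulrC. Qed.

Fact dot_scalarr u : scalar (dot u).
Proof.
move=> a v w; rewrite /dot mulr_sumr -big_split; apply: eq_bigr => i _.
by rewrite !mxE mulrDr mulrCA.
Qed.

Fact dot_scalarl v : scalar (fun u => dot u v).
Proof. by move=> a u w; rewrite !(dotC _ v) dot_scalarr. Qed.

HB.instance Definition _ :=
  bilinear_isBilinear.Build R 'rV[R]_n 'rV[R]_n R *%R *%R (@dot R n)
    (dot_scalarl, dot_scalarr).

(* Restricted to [dot], as the generic rules also rewrite ring products. *)
Let dot_form : {biscalar 'rV[R]_n} := @dot R n.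

Definition dot_bilinE := (linearDl dot_form, linearDr dot_form,
  linearBl dot_form, linearBr dot_form, linearNl dot_form, linearNr dot_form,
  linearZl_LR dot_form, linearZr_LR dot_form).

Lemma dot_ge0 u : 0 <= dot u u.
Proof. by apply: sumr_ge0 => i _; rewrite -expr2 sqr_ge0. Qed.

Lemma dot_eq0 u : (dot u u == 0) = (u == 0).
Proof.
apply/eqP/eqP => [|->]; last by rewrite linear0l.
move/psumr_eq0P => u0; apply/rowP => i; rewrite mxE; apply/eqP.
by rewrite -sqrf_eq0 expr2 u0// => j _; rewrite -expr2 sqr_ge0.
Qed.

Lemma dot_mulmx_sym A u v : A^T = A -> dot (u *m A) v = dot (v *m A) u.
Proof.
have dotE (w z : 'rV[R]_n) : dot w z = (w *m z^T) 0 0.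
  by rewrite mxE; apply: eq_bigr => i _; rewrite mxE.
by move=> As; rewrite [RHS]dotC !dotE trmx_mul As mulmxA.
Qed.

Lemma psd_CauchySchwarz A u v : A^T = A -> (forall w, 0 <= dot (w *m A) w) ->
  dot (u *m A) v ^+ 2 <= dot (u *m A) u * dot (v *m A) v.
Proof.
move=> As A_ge0.
pose p := Poly [:: dot (u *m A) u; 2 * dot (u *m A) v; dot (v *m A) v].
have p_ge0 t : 0 <= p.[t].
  have := A_ge0 (u + t *: v); rewrite mulmxDl -scalemxAl !dot_bilinE/=.
  by rewrite (dot_mulmx_sym v u As) horner_Poly/=; lra.
have := deg_le2_poly_delta_ge0 (size_Poly _ : size p <= 3)%N _ p_ge0.
by rewrite !coef_Poly/= => /(_ (A_ge0 v)); lra.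
Qed.

Lemma psd_form_eq0 A u : A^T = A -> (forall w, 0 <= dot (w *m A) w) ->
  dot (u *m A) u = 0 -> u *m A = 0.
Proof.
move=> As A_ge0 uA0; have := psd_CauchySchwarz u (u *m A) As A_ge0.
rewrite uA0 mul0r => uA_le0; apply/eqP.
by rewrite -dot_eq0 -sqrf_eq0 eq_le uA_le0 sqr_ge0.
Qed.

End DotProduct.

Section EuclideanNorm.
Context {R : realType} {n : nat}.
Implicit Types (u v w : 'rV[R]_n) (A : 'M[R]_n).

Lemma enorm_ge0 u : 0 <= enorm u.
Proof. exact: sqrtr_ge0. Qed.

Lemma sqr_enorm u : enorm u ^+ 2 = dot u u.
Proof. by rewrite sqr_sqrtr// dot_ge0. Qed.

Lemma enormN u : enorm (- u) = enorm u.
Proof. by rewrite /enorm !dot_bilinE/= opprK. Qed.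

Lemma enormC u v : enorm (u - v) = enorm (v - u).
Proof. by rewrite -enormN opprB. Qed.

Lemma enormZ a u : enorm (a *: u) = `|a| * enorm u.
Proof.
rewrite /enorm !dot_bilinE/= mulrA -expr2 sqrtrM ?sqr_ge0//.
by rewrite sqrtr_sqr.
Qed.

Lemma enorm0 : enorm (0 : 'rV[R]_n) = 0.
Proof. by rewrite /enorm linear0l sqrtr0. Qed.

Lemma enorm_eq0 u : (enorm u == 0) = (u == 0).
Proof. by rewrite -sqrf_eq0 sqr_enorm dot_eq0. Qed.

Lemma enorm_gt0 u : (0 < enorm u) = (u != 0).
Proof. by rewrite lt_neqAle enorm_ge0 andbT eq_sym enorm_eq0. Qed.

Lemma dot_le_enorm u v : `|dot u v| <= enorm u * enorm v.
Proof.
rewrite -ler_sqr ?nnegrE ?mulr_ge0 ?enorm_ge0// exprMn !sqr_enorm.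
rewrite real_normK ?num_real//.
have := @psd_CauchySchwarz R n 1%:M u v (trmx1 _ _).
by rewrite !mulmx1; apply => w; rewrite mulmx1 dot_ge0.
Qed.

Lemma ler_enormD u v : enorm (u + v) <= enorm u + enorm v.
Proof.
rewrite -ler_sqr ?nnegrE ?addr_ge0 ?enorm_ge0//.
rewrite sqrrD !sqr_enorm !dot_bilinE/= (dotC v u).
have := le_trans (ler_norm _) (dot_le_enorm u v); lra.
Qed.

Lemma enorm_triangle v u w : enorm (u - w) <= enorm (u - v) + enorm (v - w).
Proof. by rewrite (le_trans _ (ler_enormD _ _))// addrA subrK. Qed.

Lemma mxnorm_entry_le (p q : nat) (B : 'M[R]_(p, q)) i j : `|B i j| <= `|B|.
Proof.
rewrite [leRHS]/Num.norm/= mx_normrE.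
by apply/bigmax_geP; right => /=; exists (i, j).
Qed.

Lemma mxnorm_le (p q : nat) (B : 'M[R]_(p, q)) c : 0 <= c ->
  (forall i j, `|B i j| <= c) -> `|B| <= c.
Proof.
by move=> c0 Bc; rewrite [leLHS]/Num.norm/= mx_normrE; apply/bigmax_leP; split.
Qed.

Lemma ler_mxnormM (p q r : nat) (B : 'M[R]_(p, q)) (C : 'M[R]_(q, r)) :
  `|B *m C| <= q%:R * `|B| * `|C|.
Proof.
apply: mxnorm_le => [|i k]; first by rewrite !mulr_ge0.
rewrite mxE (le_trans (ler_norm_sum _ _ _))//.
rewrite -mulrA mulr_natl -[X in _ *+ X]card_ord -sumr_const.
by apply: ler_sum => j _; rewrite normrM ler_pM// mxnorm_entry_le.
Qed.

Lemma mxnorm_le_enorm u : `|u| <= enorm u.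
Proof.
apply: mxnorm_le => [|i j]; first exact: enorm_ge0.
rewrite ord1 -ler_sqr ?nnegrE ?enorm_ge0// sqr_enorm real_normK ?num_real//.
rewrite /dot (bigD1 j)//= -expr2 lerDl.
by apply: sumr_ge0 => k _; rewrite -expr2 sqr_ge0.
Qed.

Lemma enorm_le_mxnorm u : enorm u <= Num.sqrt n%:R * `|u|.
Proof.
rewrite -ler_sqr ?nnegrE ?mulr_ge0 ?enorm_ge0 ?sqrtr_ge0//.
rewrite sqr_enorm exprMn sqr_sqrtr//.
rewrite mulr_natl -[X in _ *+ X]card_ord -sumr_const.
apply: ler_sum => i _; rewrite -expr2 -real_normK ?num_real//.
by rewrite ler_sqr ?nnegrE// mxnorm_entry_le.
Qed.

Lemma enorm_mulmx_le u A :
  enorm (u *m A) <= Num.sqrt n%:R * n%:R * `|A| * enorm u.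
Proof.
apply: (le_trans (enorm_le_mxnorm _)); rewrite -!mulrA ler_wpM2l ?sqrtr_ge0//.
apply: (le_trans (ler_mxnormM _ _)); rewrite -mulrA ler_wpM2l// mulrC.
by rewrite ler_wpM2l// mxnorm_le_enorm.
Qed.

Lemma nbhs_enormP u (U : set 'rV[R]_n) :
  nbhs u U <-> exists2 r, 0 < r & forall v, enorm (v - u) < r -> U v.
Proof.
split=> [/nbhs_ballP[r/= r0 rU]|[r r0 rU]].
  exists r => // v vr; apply: rU; rewrite -ball_normE/=.
  by rewrite (le_lt_trans (mxnorm_le_enorm _))// enormC.
have c0 : 0 < Num.sqrt n%:R + 1 :> R by rewrite ltr_wpDl ?sqrtr_ge0.
apply/nbhs_ballP; exists (r / (Num.sqrt n%:R + 1)) => /=.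
  by rewrite divr_gt0.
move=> v; rewrite -ball_normE/= ltr_pdivlMr// => uvr; apply: rU.
rewrite enormC (le_lt_trans (enorm_le_mxnorm _))// (le_lt_trans _ uvr)//.
by rewrite mulrC ler_wpM2l// lerDl.
Qed.

Lemma near_enorm_lt u e : 0 < e -> \forall v \near u, enorm (v - u) < e.
Proof. by move=> e0; apply/nbhs_enormP; exists e. Qed.

Lemma enorm_sub_cvg0 u : enorm (v - u) @[v --> u] --> 0.
Proof.
apply/(@cvgr0Pnorm_lt _ _ _ (nbhs u)) => e e0; near=> v.
by rewrite ger0_norm ?enorm_ge0//; near: v; exact: near_enorm_lt.
Unshelve. all: by end_near. Qed.

Lemma cvg_enormP (T : Type) (F : set_system T) {FF : Filter F}
    (x : T -> 'rV[R]_n) u :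
  x t @[t --> F] --> u <-> enorm (x t - u) @[t --> F] --> 0.
Proof.
split=> [xu|/cvgr0Pnorm_lt xu]; first exact: cvg_comp xu (enorm_sub_cvg0 u).
move=> U /nbhs_enormP[r r0 rU]; have := xu r r0; apply: filterS => t.
by rewrite ger0_norm ?enorm_ge0//; exact: rU.
Qed.

End EuclideanNorm.

Lemma continuous_sum (R : numFieldType) (V : normedModType R)
    (T : topologicalType) (I : Type) (r : seq I) (F : I -> T -> V) :
  (forall i, continuous (F i)) -> continuous (fun t => \sum_(i <- r) F i t).
Proof.
have addc : continuous (fun x : V * V => x.1 + x.2) by exact: add_continuous.
by move=> cF; apply: (continuous_big addc) => i _; exact: cF.
Qed.

Definition opnorm_le (R : realType) (n : nat) (A : 'M[R]_n) (M : R) : Prop :=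
  forall v : 'rV[R]_n, enorm (v *m A) <= M * enorm v.

Section QuadraticForm.
Context {R : realType} {n : nat}.
Implicit Types (u v w : 'rV[R]_n) (A : 'M[R]_n).

Lemma quadratic_form_continuous A : continuous (fun u => dot (u *m A) u).
Proof.
have mulmx_coord i : continuous (fun u : 'rV[R]_n => (u *m A) 0 i).
  under eq_fun do rewrite mxE.
  apply: (continuous_sum (F := fun j u => u 0 j * A j i)) => j u.
  by apply: (@cvgM _ _ (nbhs u)); [exact: coord_continuous|exact: cvg_cst].
apply: (continuous_sum (F := fun i u => (u *m A) 0 i * u 0 i)) => i u.
by apply: (@cvgM _ _ (nbhs u)); [exact: mulmx_coord|exact: coord_continuous].
Qed.

Lemma sphere_compact : compact [set u : 'rV[R]_n | dot u u = 1].
Proof.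
apply: bounded_closed_compact.
  exists 1; split=> [|M M1 u /= u1]; first exact: num_real.
  by rewrite (le_trans (mxnorm_le_enorm u))// /enorm u1 sqrtr1 ltW.
apply: (@preimage_closed _ _ (fun u => dot u u) [set 1]) => // u _.
under eq_fun do rewrite -[X in dot X]mulmx1.
exact: quadratic_form_continuous.
Qed.

Lemma rayleigh_minimizer A v : v != 0 ->
  exists2 c, dot c c = 1 & forall u, dot (c *m A) c * dot u u <= dot (u *m A) u.
Proof.
have normalized u : u != 0 -> dot ((enorm u)^-1 *: u) ((enorm u)^-1 *: u) = 1.
  rewrite -enorm_gt0 => u0; rewrite !dot_bilinE/= -sqr_enorm; field.
  by rewrite gt_eqF.
move=> /normalized v1.
have [c + c_min] := EVT_min_rV (ex_intro _ _ v1) sphere_compact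
  (continuous_subspaceT (@quadratic_form_continuous A)).
rewrite inE => c1; exists c => // u.
have [->|u0] := eqVneq u 0; first by rewrite mul0mx !linear0l mulr0.
have := c_min ((enorm u)^-1 *: u); rewrite inE => /(_ (normalized _ u0)).
rewrite -scalemxAl !dot_bilinE/= mulrA -expr2 exprVn -sqr_enorm mulrC.
by rewrite ler_pdivlMr ?exprn_gt0 ?enorm_gt0.
Qed.

(* At a minimizer [c] of the Rayleigh quotient, with value [m], the positive
   semidefinite form [A - m] vanishes, so [c] is an eigenvector. *)
Lemma rayleigh_ge (mu : R) A v :
  sym_eig_ge mu A -> mu * dot v v <= dot (v *m A) v.
Proof.
move=> [As A_eig].
have [->|v0] := eqVneq v 0; first by rewrite mul0mx !linear0l mulr0.
have [c c1 c_min] := rayleigh_minimizer A v0; set m := dot (c *m A) c in c_min.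
apply: (le_trans _ (c_min v)); rewrite ler_wpM2r ?dot_ge0// A_eig//.
apply/eigenvalueP; exists c; last by rewrite -dot_eq0 c1 oner_eq0.
have formE w : dot (w *m (A - m%:M)) w = dot (w *m A) w - m * dot w w.
  by rewrite mulmxBr mul_mx_scalar !dot_bilinE.
apply/eqP; rewrite -subr_eq0 -mul_mx_scalar -mulmxBr; apply/eqP/psd_form_eq0.
- by rewrite linearB/= As tr_scalar_mx.
- by move=> w; rewrite formE subr_ge0.
- by rewrite formE c1 mulr1 subrr.
Qed.

Lemma sqr_mnorm (mu : R) A v : 0 <= mu -> sym_eig_ge mu A ->
  mnorm A v ^+ 2 = dot (v *m A) v.
Proof.
move=> mu0 A_mu; rewrite /mnorm (proj1 A_mu) sqr_sqrtr//.
by rewrite (le_trans _ (rayleigh_ge v A_mu))// mulr_ge0// dot_ge0.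
Qed.

Lemma sqr_mnorm_ge (mu : R) A v : 0 <= mu -> sym_eig_ge mu A ->
  mu * enorm v ^+ 2 <= mnorm A v ^+ 2.
Proof.
by move=> mu0 A_mu; rewrite (sqr_mnorm v mu0 A_mu) sqr_enorm rayleigh_ge.
Qed.

Lemma sqr_mnorm_le A M v : opnorm_le A^T M ->
  mnorm A v ^+ 2 <= M * enorm v ^+ 2.
Proof.
move=> /(_ v) AM; have [A0|A0] := leP 0 (dot (v *m A^T) v); last first.
  rewrite /mnorm ltr0_sqrtr// expr0n/= expr2 mulrA mulr_ge0 ?enorm_ge0//.
  by rewrite (le_trans _ AM)// enorm_ge0.
rewrite sqr_sqrtr// expr2 mulrA (le_trans (ler_norm _))//.
by rewrite (le_trans (dot_le_enorm _ _))// ler_wpM2r// enorm_ge0.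
Qed.

Lemma mnorm0 A : mnorm A (0 : 'rV[R]_n) = 0.
Proof. by rewrite /mnorm linear0r sqrtr0. Qed.

Lemma continuous_near_opnorm_le (T : topologicalType) (H : T -> 'M[R]_n) z :
  {for z, continuous H} ->
  exists2 M, 0 < M & \forall t \near z, opnorm_le (H t) M.
Proof.
move=> H_cont; pose c : R := Num.sqrt n%:R * n%:R.
have c0 : 0 <= c by rewrite mulr_ge0 ?sqrtr_ge0.
exists (c * (`|H z| + 1) + 1); first by rewrite ltr_wpDl// mulr_ge0.
have : \forall t \near z, `|H t| < `|H z| + 1.
  by apply: (cvgr_norm_lt _ H_cont); rewrite ltrDl.
apply: filterS => t Ht u; rewrite (le_trans (enorm_mulmx_le _ _))// -/c.
by rewrite ler_wpM2r ?enorm_ge0// ler_wpDr// ler_wpM2l// ltW.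
Qed.

End QuadraticForm.

Definition has_gradient (R : realType) (n : nat) (q : 'rV[R]_n -> R)
    (z v : 'rV[R]_n) : Prop :=
  forall e, 0 < e -> \forall y \near z,
    `|q y - q z - dot v (y - z)| <= e * enorm (y - z).

Section Gradients.
Context {R : realType} {n : nat}.
Implicit Types (u v w y z : 'rV[R]_n) (h : 'rV[R]_n -> \bar R).
Implicit Types (p q : 'rV[R]_n -> R).

Lemma diff_dot_gradient p z v : 'd p z v = dot (gradient p z) v.
Proof.
rewrite {1}(row_sum_delta v) linear_sum; apply: eq_bigr => i _.
by rewrite linearZ/= mxE mulrC.
Qed.

Lemma differentiable_has_gradient p z :
  differentiable p z -> has_gradient p z (gradient p z).
Proof.
move=> /diff_locally/eqaddoP dp e e0.
rewrite (near_shift 0); have := dp e e0; apply: filterS => u/=.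
rewrite subr0 addrK -diff_dot_gradient opprD addrA => /le_trans; apply.
by rewrite ler_pM2l// mxnorm_le_enorm.
Qed.

Lemma has_gradientD p q z v w :
  has_gradient p z v -> has_gradient q z w ->
  has_gradient (fun y => p y + q y) z (v + w).
Proof.
move=> pv qw e e0; near=> y.
have -> : p y + q y - (p z + q z) - dot (v + w) (y - z) =
    (p y - p z - dot v (y - z)) + (q y - q z - dot w (y - z)).
  by rewrite dot_bilinE/=; ring.
rewrite (le_trans (ler_normD _ _))// [e]splitr mulrDl lerD//.
- by near: y; apply: pv; rewrite divr_gt0.
- by near: y; apply: qw; rewrite divr_gt0.
Unshelve. all: by end_near. Qed.

Lemma has_gradient_quadratic (A : 'M[R]_n) c u z : A^T = A ->
  has_gradient (fun y => c / 2 * dot ((y - u) *m A) (y - u)) z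
    (c *: ((z - u) *m A)).
Proof.
move=> As e e0.
pose K := `|c / 2| * (Num.sqrt n%:R * n%:R * `|A|).
have K0 : 0 <= K by rewrite !mulr_ge0 ?sqrtr_ge0.
near=> y.
have -> : y - u = (z - u) + (y - z) by rewrite [RHS]addrC addrA subrK.
have yz : enorm (y - z) < e / (K + 1).
  by near: y; apply: near_enorm_lt; rewrite divr_gt0// ltr_wpDl.
move: (z - u) (y - z) yz => s t t_lt.
have -> : c / 2 * dot ((s + t) *m A) (s + t) - c / 2 * dot (s *m A) s -
    dot (c *: (s *m A)) t = c / 2 * dot (t *m A) t.
  by rewrite mulmxDl !dot_bilinE/= (dot_mulmx_sym t s As); field.
rewrite normrM (@le_trans _ _ (K * enorm t * enorm t))//.
  rewrite -!mulrA ler_wpM2l// (le_trans (dot_le_enorm _ _))// !mulrA.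
  by rewrite ler_wpM2r ?enorm_ge0// enorm_mulmx_le.
rewrite ler_wpM2r ?enorm_ge0//; move: t_lt; rewrite ltr_pdivlMr ?ltr_wpDl//.
have := enorm_ge0 t; lra.
Unshelve. all: by end_near. Qed.

Lemma regular_subdiff_near h z v : h z \is a fin_num ->
  (forall e, 0 < e -> \forall y \near z,
    ((fine (h z) + dot v (y - z) - e * enorm (y - z))%:E <= h y)%E) ->
  regular_subdiff h z v.
Proof.
move=> hz h_ge; split; first by rewrite /edom/= ltey_eq hz.
rewrite limf_einfE; apply/lee_addgt0Pr => e e0.
rewrite -leeBlDr// sub0e.
pose quotient y :=
  ((h y - h z - (dot v (y - z))%:E) * ((enorm (y - z))^-1)%:E)%E.
pose V := [set y | y != z /\
  ((fine (h z) + dot v (y - z) - e * enorm (y - z))%:E <= h y)%E].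
apply: (@le_trans _ _ (ereal_inf [set quotient y | y in V])).
  apply/ereal_infP => _ [y [yz y_ge] <-].
  have yz0 : 0 < enorm (y - z) by rewrite enorm_gt0 subr_eq0.
  move: y_ge; rewrite /quotient -(fineK hz); case: (h y) => [r||]//=.
    rewrite !lee_fin => y_ge; rewrite ler_pdivlMr//; lra.
  by move=> _; rewrite gt0_mulye ?leey// lte_fin invr_gt0.
apply: ereal_sup_ubound; exists V => //.
by have := h_ge _ e0; rewrite /dnbhs /within/=; apply: filterS => y ? ?; split.
Qed.

Lemma regular_subdiff_subdiff h z : regular_subdiff h z `<=` subdiff h z.
Proof.
move=> v [dz hv]; split => //; exists (fun=> z), (fun=> v).
by split => //; exact: cvg_cst.
Qed.

Lemma has_gradient_subdiff p z v :
  has_gradient p z v -> subdiff (EFin \o p) z v.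
Proof.
move=> pv; apply/regular_subdiff_subdiff/regular_subdiff_near => // e e0.
have := pv e e0; apply: filterS => y.
by rewrite ler_norml lee_fin => /andP[+ _]/=; lra.
Qed.

Lemma regular_subdiff_local_min h q z v : h z \is a fin_num ->
  has_gradient q z v ->
  (\forall y \near z, (h z + (q z)%:E <= h y + (q y)%:E)%E) ->
  regular_subdiff h z (- v).
Proof.
move=> hz qv z_min; apply: regular_subdiff_near => // e e0; near=> y.
have : (h z + (q z)%:E <= h y + (q y)%:E)%E by near: y.
have : `|q y - q z - dot v (y - z)| <= e * enorm (y - z) by near: y; exact: qv.
rewrite -(fineK hz) !dot_bilinE/= ler_norml => /andP[_].
by case: (h y) => [r||]//=; [rewrite !lee_fin; lra|move=> *; exact: leey].
Unshelve. all: by end_near. Qed.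

Lemma gradient_growth p z L :
  (forall y, differentiable p y) ->
  (forall y, enorm (gradient p y) <= L * enorm (y - z)) ->
  forall y, `|p y - p z| <= L * enorm (y - z) ^+ 2.
Proof.
move=> dp pL y; pose u := y - z; pose q t := p (z + t *: u).
have dq (t : R) : is_derive t (1 : R) q (dot (gradient p (z + t *: u)) u).
  have dpt : derivable p (z + t *: u) u by exact: diff_derivable.
  have quotientE : (fun s : R => s^-1 *: ((q \o shift t) (s *: 1) - q t)) =
      fun s : R =>
        s^-1 *: ((p \o shift (z + t *: u)) (s *: u) - p (z + t *: u)).
    by apply/funext => s /=; rewrite /q /= scalerDl [_ *: 1]mulr1 addrCA.
  split; first by rewrite /derivable quotientE.
  by rewrite /derive quotientE -/(derive p _ u) deriveE// diff_dot_gradient.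
have cq : {within `[0, 1], continuous q}.
  by apply: derivable_within_continuous => t _; exact: ex_derive.
have [c] := MVT ltr01 (fun t _ => dq t) cq.
rewrite in_itv/= => /andP[c0 c1].
rewrite /q scale1r [z + u]addrC subrK scale0r addr0 subr0 mulr1 => ->.
have L0 : 0 <= L * enorm u by rewrite (le_trans _ (pL y))// enorm_ge0.
rewrite (le_trans (dot_le_enorm _ _))// expr2 mulrA ler_wpM2r ?enorm_ge0//.
rewrite (le_trans (pL _))// [z + _]addrC addrK enormZ gtr0_norm// mulrCA.
by rewrite ler_piMl// ltW.
Qed.

End Gradients.

Section Desingularizing.
Context {R : realType}.
Implicit Types (D : set R) (eta s t a B d : R) (phi : R -> R).

Lemma concave_on_le_tangent D phi s t :
  concave_on D phi -> D s -> D t -> derivable phi s 1 ->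
  phi t <= phi s + derive1 phi s * (t - s).
Proof.
move=> phi_concave Ds Dt /derivable1_diffP dphi.
pose Q h := h^-1 *: (phi (h *: (t - s) + s) - phi s).
have Q_cvg : Q h @[h --> 0^'+] --> derive1 phi s * (t - s).
  have -> : derive1 phi s * (t - s) = 'D_(t - s) phi s.
    by rewrite derive1E !deriveE// -[in RHS](mulr1 (t - s)) linearZ/= mulrC.
  exact/cvg_dnbhs_at_right/diff_derivable.
rewrite -lerBlDl -(cvg_lim _ Q_cvg)//.
apply: limr_ge; first by apply/cvg_ex; exists (derive1 phi s * (t - s)).
near=> h.
have h0 : 0 < h by [].
have h1 : h <= 1 by near: h; exact: nbhs_right_le.
have := phi_concave t s h Dt Ds; rewrite (ltW h0) h1 => /(_ isT).
have -> : h * t + (1 - h) * s = h * (t - s) + s by ring.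
by rewrite /Q [_ *: _]mulrC ler_pdivlMr// [_ *: _]/(_ * _); lra.
Unshelve. all: by end_near. Qed.

Lemma desingularizing_cvg0 eta phi (s : R^nat) : 0 < eta ->
  desingularizing eta phi -> (forall k, 0 <= s k) ->
  s @ \oo --> 0 -> phi (s k) @[k --> \oo] --> 0.
Proof.
move=> eta0 [/(continuous_within_itvP _ eta0)[_ phi_cvg _] _ _ phi0 _] s0 s_cvg.
apply/cvgr0Pnorm_lt => e e0; rewrite phi0 in phi_cvg.
have /cvgr0_norm_lt/(_ _ e0) := phi_cvg.
rewrite /at_right near_withinE => /s_cvg.
apply: (@filterS _ \oo) => k /=.
have := s0 k; rewrite le_eqVlt => /predU1P[<- _|sk /(_ sk)//].
by rewrite phi0 normr0.
Qed.

Lemma AGM2_double_le d d' c : 0 <= d -> 0 <= c ->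
  d' ^+ 2 <= d * c -> 2 * d' <= d + c.
Proof.
move=> d0 c0 d'_le; have [d'0|d'0] := ltP d' 0.
  by rewrite (@le_trans _ _ 0)// ?addr_ge0// pmulr_rle0// ltW.
rewrite -ler_sqr ?nnegrE ?addr_ge0 ?mulr_ge0//.
have := sqr_ge0 (d - c); lra.
Qed.

(* Concavity gives [phi' s * a * d' ^ 2 <= phi s - phi s'], and multiplying by
   [B * d >= 1 / phi' s] yields [d' ^ 2 <= d * (B / a * (phi s - phi s'))]. *)
Lemma desingularizing_step_le eta phi a B s s' d d' :
  desingularizing eta phi -> 0 < a -> 0 < B -> 0 <= d -> 0 <= d' ->
  0 <= s' -> s < eta -> s' + a * d' ^+ 2 <= s ->
  (0 < s -> 1 <= derive1 phi s * (B * d)) ->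
  2 * d' <= d + B / a * (phi s - phi s').
Proof.
move=> [_ phi_concave _ _ dphi] a0 B0 d0 d'0 s'0 s_eta s'_le slope.
have ad0 : 0 <= a * d' ^+ 2 by rewrite mulr_ge0 ?sqr_ge0// ltW.
have s's : s' <= s by rewrite (le_trans _ s'_le)// lerDl.
have := le_trans s'0 s's; rewrite le_eqVlt => /predU1P[s0|s0].
  have s'E : s' = s by apply/le_anti; rewrite s's -s0 s'0.
  have : a * d' ^+ 2 <= 0 by lra.
  rewrite pmulr_rle0// le_eqVlt ltNge sqr_ge0 orbF sqrf_eq0 => /eqP ->.
  by rewrite s'E subrr !mulr0 addr0.
have [|dphis _ phi'_gt0] := dphi s; first by rewrite in_itv/= s0.
have drop_ge : derive1 phi s * (a * d' ^+ 2) <= phi s - phi s'.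
  have := @concave_on_le_tangent _ _ s s' phi_concave _ _ dphis.
  rewrite /= !in_itv/= !(ltW s0, ltW s_eta, s'0, le_trans s's (ltW s_eta)).
  move=> /(_ isT isT) tangent.
  have := ler_wpM2l (ltW phi'_gt0) s'_le; lra.
have drop_ge0 : 0 <= phi s - phi s'.
  by rewrite (le_trans _ drop_ge)// mulr_ge0// ltW.
apply: AGM2_double_le => //.
  by rewrite mulr_ge0// divr_ge0// ltW.
have := ler_wpM2l ad0 (slope s0); rewrite mulr1.
have := ler_wpM2l (mulr_ge0 (ltW B0) d0) drop_ge.
have -> : d * (B / a * (phi s - phi s')) = B * d * (phi s - phi s') / a.
  by rewrite mulrCA mulrAC; ring.
by rewrite ler_pdivlMr//; lra.
Qed.

End Desingularizing.

Section Sequences.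
Context {R : realType}.

Lemma cluster_near_ex (T : topologicalType) (x : nat -> T) z (P : set nat)
    (U : set T) :
  cluster (x @ \oo) z ->
  (\forall k \near \oo, P k) -> (\forall u \near z, U u) ->
  exists2 k, P k & U (x k).
Proof.
move=> x_z nP nU.
have [|u [[k Pk <-] Uxk]] := x_z [set x k | k in P] U _ nU; last by exists k.
by apply: filterS nP => k Pk; exists k.
Qed.

Lemma cluster_cvg_comp (T S : topologicalType) (F : set_system T) z
    (h : T -> S) l :
  h u @[u --> z] --> l -> cluster F z -> cluster (h t @[t --> F]) l.
Proof.
move=> h_cvg F_z A B FA nB; have [t [At Bt]] := F_z _ _ FA (h_cvg _ nB).
by exists (h t).
Qed.

Lemma nonincreasing_values_cvg (T : topologicalType) (f : T -> \bar R)
    (x : nat -> T) z (U : set T) (h : T -> R) :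
  lower_semicontinuous f -> f z \is a fin_num ->
  (forall k, f (x k) \is a fin_num) ->
  nonincreasing_seq (fun k => fine (f (x k))) -> cluster (x @ \oo) z ->
  nbhs z U -> h u @[u --> z] --> fine (f z) ->
  (forall k, U (x k) -> fine (f (x k.+1)) <= h (x k)) ->
  fine (f (x k)) @[k --> \oo] --> fine (f z).
Proof.
move=> f_lsc fz fx fx_noninc x_z nU h_cvg fx_le.
have fz_le k : fine (f z) <= fine (f (x k)).
  rewrite leNgt; apply/negP => fk.
  have [|V nV fV] := f_lsc z (fine (f (x k))).
    by rewrite -(fineK fz) lte_fin.
  have [j kj Vj] := cluster_near_ex x_z (nbhs_infty_ge k) nV.
  by have := fV _ Vj; rewrite -(fineK (fx j)) lte_fin ltNge fx_noninc.
apply/cvgrPdist_lt => e e0.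
have h_lt : \forall u \near z, h u < fine (f z) + e.
  by apply: cvgr_lt h_cvg _ _; rewrite ltrDl.
have [k _ [Uk hk]] := cluster_near_ex x_z (nbhs_infty_ge 0) (filterI nU h_lt).
exists k.+1 => // j /= kj; rewrite distrC ger0_norm ?subr_ge0// ltrBlDl.
by rewrite (le_lt_trans (fx_noninc _ _ kj))// (le_lt_trans (fx_le _ Uk)).
Qed.

(* [V k = E k.+1 + d k + P k.+1] does not increase once it is below [rho], and
   it is small infinitely often. *)
Lemma trapped_cvg0 (E d P : R^nat) rho : 0 < rho ->
  (forall k, 0 <= E k) -> (forall k, 0 <= d k) ->
  (forall k, E k.+1 <= E k + d k) -> (forall k, E k <= E k.+1 + d k) ->
  (\forall k \near \oo, 0 <= P k) ->
  (\forall k \near \oo, E k < rho -> E k.+1 < rho ->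
    2 * d k.+1 <= d k + (P k.+1 - P k.+2)) ->
  d @ \oo --> 0 -> P @ \oo --> 0 -> cluster (E @ \oo) 0 -> E @ \oo --> 0.
Proof.
move=> rho0 E0 d0 EdS Ed P0 step d_cvg P_cvg /cluster_eventuallyP E_freq.
pose V k := E k.+1 + d k + P k.+1.
apply/cvgr0Pnorm_lt => e e0.
have [m [m0 m_rho m_e]] : exists m, [/\ 0 < m, m <= rho & m <= e].
  by exists (Num.min rho e); rewrite lt_min rho0 e0 !ge_min !lexx orbT.
have m3 : 0 < m / 3 by rewrite divr_gt0.
have [N _ N_ok] : \forall k \near \oo, [/\ 0 <= P k, P k < m / 3, d k < m / 3 &
    E k < rho -> E k.+1 < rho -> 2 * d k.+1 <= d k + (P k.+1 - P k.+2)].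
  near=> k; split; last by near: k; exact: step.
  - by near: k.
  - by near: k; apply: cvgr_lt P_cvg _ _.
  - by near: k; apply: cvgr_lt d_cvg _ _.
have V_dec k : (N <= k)%N -> V k < m -> V k.+1 <= V k.
  move=> Nk Vk_lt.
  have [_ _ _] := N_ok _ Nk; have [P1 _ _ _] := N_ok _ (leqW Nk).
  have := Ed k; have := EdS k.+1; have := d0 k; have := E0 k.+1.
  by rewrite /V in Vk_lt *; lra.
have [[//|K] NK EK] := E_freq _ N.+1 m3; rewrite ltnS in NK.
have V_small j : V (K + j)%N < m.
  elim: j => [|j IH]; last first.
    by rewrite addnS (le_lt_trans (V_dec _ _ IH))// (leq_trans NK)// leq_addr.
  have [_ PK _ _] := N_ok _ (leqW NK); have [_ _ dK _] := N_ok _ NK.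
  by move: EK; rewrite addn0 sub0r normrN ger0_norm// /V; lra.
exists K.+1 => // -[//|k] /= Kk; rewrite ger0_norm//.
have := V_small (k - K)%N; rewrite subnKC//.
have [P1 _ _ _] := N_ok k.+1 (leqW (leq_trans NK Kk)); rewrite /V.
by have := d0 k; lra.
Unshelve. all: by end_near. Qed.

End Sequences.

Definition sufficient_decrease (R : realType) (n : nat) (f : 'rV[R]_n -> \bar R)
    (a : R) (x : nat -> 'rV[R]_n) : Prop :=
  forall k, fine (f (x k.+1)) + a * enorm (x k.+1 - x k) ^+ 2 <= fine (f (x k)).

Definition relative_error (R : realType) (n : nat) (f : 'rV[R]_n -> \bar R)
    (U : set 'rV[R]_n) (B : R) (x : nat -> 'rV[R]_n) : Prop :=
  forall k, U (x k) -> exists2 w, regular_subdiff f (x k.+1) w &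
    enorm w <= B * enorm (x k.+1 - x k).

Lemma edom_fin_num (R : realType) (n : nat) (f : 'rV[R]_n -> \bar R) z :
  proper_fun f -> edom f z -> f z \is a fin_num.
Proof. by move=> [fNy _] fz; rewrite fin_numE fNy/= (lt_eqF fz). Qed.

Lemma KL_property_fin_num (R : realType) (n : nat) (f : 'rV[R]_n -> \bar R) z :
  KL_property f z -> f z \is a fin_num.
Proof. by case=> f_proper _ [v [z_dom _]] _; exact: edom_fin_num. Qed.

Section KLDescent.
Context {R : realType} {n : nat}.
Variables (f : 'rV[R]_n -> \bar R) (x : nat -> 'rV[R]_n) (xs : 'rV[R]_n).
Variables (a B : R) (U : set 'rV[R]_n).
Hypotheses (fx_fin : forall k, f (x k) \is a fin_num).
Hypotheses (a_gt0 : 0 < a) (B_gt0 : 0 < B) (nU : nbhs xs U).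
Hypotheses (x_decrease : sufficient_decrease f a x).
Hypotheses (x_error : relative_error f U B x).
Hypotheses (fx_cvg : fine (f (x k)) @[k --> \oo] --> fine (f xs)).

Let E k := enorm (x k - xs).
Let d k := enorm (x k.+1 - x k).
Let gap k := fine (f (x k)) - fine (f xs).

Lemma sufficient_decrease_nonincreasing :
  nonincreasing_seq (fun k => fine (f (x k))).
Proof.
apply/nonincreasing_seqP => k; rewrite (le_trans _ (x_decrease k))// lerDl.
by rewrite mulr_ge0 ?sqr_ge0// ltW.
Qed.

Lemma value_gap_ge0 k : 0 <= gap k.
Proof.
rewrite subr_ge0 -(cvg_lim _ fx_cvg)//.
apply: (nonincreasing_cvgn_ge sufficient_decrease_nonincreasing).
by apply/cvg_ex; exists (fine (f xs)).
Qed.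

Lemma value_gap_cvg0 : gap @ \oo --> 0.
Proof.
by rewrite -(subrr (fine (f xs))); apply: cvgB => //; exact: cvg_cst.
Qed.

Lemma value_gapS_le k : gap k.+1 + a * d k ^+ 2 <= gap k.
Proof. by rewrite /gap addrAC lerD2r; exact: x_decrease. Qed.

Lemma step_length_cvg0 : d @ \oo --> 0.
Proof.
apply: (@squeeze_cvgr _ _ _ _ (cst 0) (fun k => Num.sqrt (a^-1 * gap k))).
- apply: nearW => k; rewrite enorm_ge0/= -[leLHS]ger0_norm ?enorm_ge0//.
  rewrite -sqrtr_sqr ler_wsqrtr// ler_pdivlMl//.
  by rewrite (le_trans _ (value_gapS_le k))// lerDr value_gap_ge0.
- exact: cvg_cst.
- rewrite -[X in _ --> X]sqrtr0 -[X in Num.sqrt X](mulr0 a^-1).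
  apply: cvg_comp; last exact: sqrt_continuous.
  by apply: cvgMr; exact: value_gap_cvg0.
Qed.

Lemma KL_step_le : KL_property f xs -> exists eta phi rho : _,
  [/\ 0 < eta, desingularizing eta phi, 0 < rho &
    forall k, E k < rho -> E k.+1 < rho -> gap k.+1 < eta ->
      2 * d k.+1 <= d k + B / a * (phi (gap k.+1) - phi (gap k.+2))].
Proof.
move=> f_KL; have fxs := KL_property_fin_num f_KL.
have [_ _ _ [eta [V [phi [eta0 nV phiD KL]]]]] := f_KL.
have /nbhs_enormP[rho rho0 UV_rho] : nbhs xs (U `&` V) by exact: filterI.
exists eta, phi, rho; split=> // k /UV_rho[Uk _] /UV_rho[_ VkS] gap_lt.
apply: (desingularizing_step_le phiD) => //;
  rewrite ?enorm_ge0 ?value_gap_ge0 ?value_gapS_le// => gap_gt0.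
have [w w_sub w_le] := x_error Uk.
have [_ _ _ _ dphi] := phiD.
have [|_ _ phi'_gt0] := dphi (gap k.+1); first by rewrite in_itv/= gap_gt0.
have := KL _ VkS; rewrite -(fineK (fx_fin k.+1)) -(fineK fxs) !lte_fin.
rewrite -ltrBlDl -subr_gt0 => /(_ gap_gt0 gap_lt) KL_le.
rewrite -lee_fin EFinM (le_trans KL_le)// lee_pmul2l ?lte_fin//.
apply: ge_ereal_inf; exists (enorm (0 - w))%:E.
  by exists w => //; exact: regular_subdiff_subdiff.
by rewrite sub0r enormN lee_fin.
Qed.

Lemma KL_iterates_cvg :
  KL_property f xs -> cluster (x @ \oo) xs -> x @ \oo --> xs.
Proof.
move=> f_KL xs_acc.
have [eta [phi [rho [eta0 phiD rho0 step]]]] := KL_step_le f_KL.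
have gap_lt : \forall k \near \oo, gap k < eta.
  exact: cvgr_lt value_gap_cvg0 _ _.
have [_ _ phi_ge0 _ _] := phiD.
apply/cvg_enormP.
apply: (@trapped_cvg0 _ E d (fun k => B / a * phi (gap k)) rho).
- exact: rho0.
- by move=> k; exact: enorm_ge0.
- by move=> k; exact: enorm_ge0.
- by move=> k; rewrite addrC; exact: enorm_triangle.
- by move=> k; rewrite addrC /d enormC; exact: enorm_triangle.
- near=> k; apply: mulr_ge0; first by rewrite divr_ge0// ltW.
  by apply: phi_ge0; rewrite in_itv/= value_gap_ge0 ltW//; near: k.
- near=> k => Ek EkS; rewrite -mulrBr step//.
  have gapk_lt : gap k < eta by near: k.
  by rewrite (le_lt_trans _ gapk_lt)// lerD2r sufficient_decrease_nonincreasing.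
- exact: step_length_cvg0.
- rewrite -(mulr0 (B / a)); apply: cvgMr.
  exact: desingularizing_cvg0 eta0 phiD value_gap_ge0 value_gap_cvg0.
- exact: cluster_cvg_comp (@enorm_sub_cvg0 _ _ xs) xs_acc.
Unshelve. all: by end_near. Qed.

Lemma relative_error_limit_stationary :
  f xs \is a fin_num -> x @ \oo --> xs -> stationary f xs.
Proof.
move=> fxs x_cvg; have xs_dom : edom f xs by rewrite /edom/= ltey_eq fxs.
have [N _ NU] := x_cvg _ nU.
have /choice[w w_P] k : exists w, regular_subdiff f (x (k + N).+1) w /\
    enorm w <= B * d (k + N)%N.
  by have [|w ? ?] := x_error (k := k + N); [exact/NU/leq_addl|exists w].
split=> //; split=> //; exists (fun k => x (k + N).+1), w; split.
- by rewrite (cvg_shiftn N (fun k => x k.+1)) cvg_shiftS.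
- rewrite -(fineK fxs); apply: cvg_EFin.
    by apply: nearW => k; exact: fx_fin.
  rewrite (cvg_shiftn N (fun k => fine (f (x k.+1)))).
  by rewrite (cvg_shiftS (fun k => fine (f (x k)))).
- by move=> k; have [] := w_P k.
- apply/cvg_enormP.
  apply: (@squeeze_cvgr _ _ _ _ (cst 0) (fun k => B * d (k + N)%N)).
  + by apply: nearW => k; have [_ w_le] := w_P k; rewrite subr0 enorm_ge0.
  + exact: cvg_cst.
  + rewrite -(mulr0 B); apply: cvgMr; rewrite cvg_shiftn.
    exact: step_length_cvg0.
Qed.

Theorem KL_descent_cvg : KL_property f xs -> cluster (x @ \oo) xs ->
  x @ \oo --> xs /\ stationary f xs.
Proof.
move=> f_KL xs_acc; have x_cvg := KL_iterates_cvg f_KL xs_acc; split=> //.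
exact: relative_error_limit_stationary (KL_property_fin_num f_KL) x_cvg.
Qed.

End KLDescent.

Lemma local_model_center (R : realType) (n : nat) (f m : 'rV[R]_n -> \bar R) z :
  f z \is a fin_num -> local_model f z m -> m z = f z.
Proof.
move=> fz [_ _ _ [w [_ _ w0 _] /nbhs_singleton m_near]].
have := m_near; rewrite /edom/= ltey_eq fz subrr enorm0 w0 => /(_ isT).
rewrite -(fineK fz); case: (m z) => [r| |]; rewrite //= ?leye_eq// lee_fin.
by rewrite normr_le0 subr_eq0 => /eqP ->.
Qed.

Section ProximalStep.
Context {R : realType} {n : nat}.
Variables (f m : 'rV[R]_n -> \bar R) (p : 'rV[R]_n -> R) (A : 'M[R]_n).
Variables (mu gam delta : R) (u y : 'rV[R]_n).
Hypotheses (f_proper : proper_fun f) (u_dom : edom f u).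
Hypotheses (mE : forall z, m z = ((p z)%:E + f z)%E).
Hypotheses (y_min : global_min (subproblem m A gam u) y).

Lemma global_min_edom : edom f y.
Proof.
have := y_min u; rewrite /subproblem !mE.
move: u_dom; rewrite /edom/=; case: (f y) => [r||]//; first by rewrite ltry.
by case: (f u) => [||]//= r _; rewrite leye_eq.
Qed.

Lemma acceptableE : acceptable f m A delta gam u y <->
  `|p y| <= delta * (gam / 2) * mnorm A (y - u) ^+ 2.
Proof.
rewrite /acceptable mE -(fineK (edom_fin_num f_proper global_min_edom)) lee_fin.
by rewrite distrC addrK.
Qed.

Lemma acceptable_large_stepsize L : 0 <= mu -> sym_eig_ge mu A ->
  0 <= delta * gam -> 2 * L <= delta * mu * gam ->
  `|p y| <= L * enorm (y - u) ^+ 2 -> acceptable f m A delta gam u y.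
Proof.
move=> mu0 A_mu delta_gam gam_ge p_le.
apply/acceptableE; apply: (le_trans p_le).
have := ler_wpM2l delta_gam (sqr_mnorm_ge (y - u) mu0 A_mu).
have := ler_wpM2r (sqr_ge0 (enorm (y - u))) gam_ge; lra.
Qed.

Lemma acceptable_min_le z : edom f z -> acceptable f m A delta gam u y ->
  fine (f y) + (1 - delta) * (gam / 2 * mnorm A (y - u) ^+ 2) <=
  fine (f z) + p z + gam / 2 * mnorm A (z - u) ^+ 2.
Proof.
move=> z_dom /acceptableE; rewrite ler_norml => /andP[p_ge _].
have := y_min z; rewrite /subproblem !mE.
rewrite -(fineK (edom_fin_num f_proper global_min_edom)).
by rewrite -(fineK (edom_fin_num f_proper z_dom)) -!EFinD lee_fin; lra.
Qed.

Lemma global_min_regular_subdiff : 0 <= mu -> sym_eig_ge mu A ->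
  differentiable p y ->
  regular_subdiff f y (- (gradient p y + gam *: ((y - u) *m A))).
Proof.
move=> mu0 A_mu dp; have y_fin := edom_fin_num f_proper global_min_edom.
apply: (@regular_subdiff_local_min _ _ _
    (fun z => p z + gam / 2 * dot ((z - u) *m A) (z - u))) => //.
  apply: has_gradientD; first exact: differentiable_has_gradient.
  exact: has_gradient_quadratic (proj1 A_mu).
apply: (@nearW _ (nbhs y)) => z; have := y_min z; rewrite /subproblem !mE.
by rewrite !(sqr_mnorm _ mu0 A_mu) !EFinD ![(_ + f _)%E]addeC !addeA.
Qed.

End ProximalStep.

Section ModelProximalQuasiNewton.
Context {R : realType} {n : nat}.
Variables (f : 'rV[R]_n -> \bar R) (F : 'rV[R]_n -> 'rV[R]_n -> \bar R).
Variables (g : 'rV[R]_n -> 'rV[R]_n -> R) (H : 'rV[R]_n -> 'M[R]_n).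
Variables (tau mu gmin gmax delta L : R) (x : nat -> 'rV[R]_n).
Hypotheses (f_proper : proper_fun f).
Hypotheses (x_mpqn : mpqn_sequence f F H tau gmin gmax delta x).
Hypotheses (F_model : forall xb, edom f xb -> local_model f xb (F xb)).
Hypotheses (F_split : forall xb, edom f xb ->
  forall z, F xb z = ((g xb z)%:E + f z)%E).
Hypotheses (g_smooth : forall xb, edom f xb -> smooth (g xb)).
Hypotheses (g_subdiff : forall xb, edom f xb -> forall z,
  subdiff (fun y => (g xb y)%:E) z `<=`
    [set L *: v | v in ecball (enorm (z - xb)) 0]).
Hypotheses (H_sym : forall z, sym_eig_ge mu (H z)).
Hypotheses (tau_gt1 : 1 < tau) (mu_gt0 : 0 < mu) (gmin_gt0 : 0 < gmin).
Hypotheses (delta_gt0 : 0 < delta) (delta_lt1 : delta < 1) (L_gt0 : 0 < L).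

Definition stepsize_bound : R := tau * Num.max gmax (2 * L / (delta * mu)).

Lemma model_gap_center u : edom f u -> g u u = 0.
Proof.
move=> fu; have := local_model_center (edom_fin_num f_proper fu) (F_model fu).
rewrite (F_split fu) -(fineK (edom_fin_num f_proper fu)) -EFinD => -[].
by move=> /eqP; rewrite -subr_eq0 addrK => /eqP.
Qed.

Lemma model_gap_gradient u z : edom f u ->
  enorm (gradient (g u) z) <= L * enorm (z - u).
Proof.
move=> fu; have [dg _] := g_smooth fu.
have dg_z := differentiable_has_gradient (dg z).
have [v] := g_subdiff fu (has_gradient_subdiff dg_z).
by rewrite /ecball/= subr0 => v_le <-; rewrite enormZ gtr0_norm// ler_pM2l.
Qed.

Lemma model_gap_le u z : edom f u -> `|g u z| <= L * enorm (z - u) ^+ 2.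
Proof.
move=> fu; have [dg _] := g_smooth fu.
have := gradient_growth dg (fun y => model_gap_gradient y fu) z.
by rewrite model_gap_center// subr0.
Qed.

Lemma mpqn_step_accepted u y : edom f u ->
  mpqn_step f F H tau gmin gmax delta u y ->
  exists gam, [/\ gmin <= gam <= stepsize_bound,
    global_min (subproblem (F u) (H u) gam u) y &
    acceptable f (F u) (H u) delta gam u y].
Proof.
move=> fu [g0 [t [ik [/andP[g0_ge g0_le] t_min t_rej t_acc ->]]]].
have tau0 : 0 < tau by exact: lt_trans tau_gt1.
have g0_gt0 : 0 < g0 by exact: lt_le_trans g0_ge.
exists (tau ^+ ik.+1 * g0); split=> //; last exact: t_min.
apply/andP; split.
  rewrite (le_trans g0_ge)// ler_peMl ?(ltW g0_gt0)//.
  by rewrite exprn_ege1// ltW.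
case: ik t_min t_rej {t_acc} => [|i] t_min t_rej.
  by rewrite expr1 ler_pM2l// le_max g0_le.
rewrite exprS -mulrA ler_pM2l// le_max orbC leNgt.
have gi0 : 0 < tau ^+ i.+1 * g0 by rewrite mulr_gt0// exprn_gt0.
apply/orP; left; apply/negP => gi_gt; apply: (t_rej i (ltnSn i)).
apply: (@acceptable_large_stepsize _ _ _ _ _ _ mu _ _ _ _ f_proper fu
  (F_split fu) (t_min i (leqnSn i)) L) => //.
- exact: ltW.
- by rewrite mulr_ge0// ltW.
- by move: gi_gt; rewrite ltr_pdivrMr ?mulr_gt0// => /ltW; lra.
- exact: model_gap_le.
Qed.

Lemma mpqn_edom k : edom f (x k).
Proof.
have [x0_dom x_step] := x_mpqn; elim: k => // k xk_dom.
have [gam [_ xkS_min _]] := mpqn_step_accepted xk_dom (x_step k).2.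
exact: global_min_edom xk_dom (F_split xk_dom) xkS_min.
Qed.

Lemma mpqn_iterate k : exists gam, [/\ gmin <= gam <= stepsize_bound,
  global_min (subproblem (F (x k)) (H (x k)) gam (x k)) (x k.+1) &
  acceptable f (F (x k)) (H (x k)) delta gam (x k) (x k.+1)].
Proof. exact: mpqn_step_accepted (mpqn_edom k) (x_mpqn.2 k).2. Qed.

Lemma mpqn_sufficient_decrease :
  sufficient_decrease f ((1 - delta) * (gmin / 2 * mu)) x.
Proof.
move=> k; have [gam [/andP[gam_ge _] xkS_min xkS_acc]] := mpqn_iterate k.
have := acceptable_min_le f_proper (mpqn_edom k) (F_split (mpqn_edom k)) xkS_min
  (mpqn_edom k) xkS_acc.
rewrite (model_gap_center (mpqn_edom k)) subrr mnorm0 expr0n/= mulr0 !addr0.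
apply: le_trans; rewrite lerD2l -(mulrA (1 - delta)) ler_pM2l ?subr_gt0//.
rewrite -[leLHS]mulrA ler_pM ?divr_ge0 ?(ltW gmin_gt0)//; first last.
- exact: sqr_mnorm_ge (ltW mu_gt0) (H_sym _).
- by rewrite ler_pM2r.
- by rewrite mulr_ge0 ?sqr_ge0// ltW.
Qed.

Lemma mpqn_relative_error M : 0 <= M ->
  relative_error f [set u | opnorm_le (H u) M] (L + stepsize_bound * M) x.
Proof.
move=> M0 k H_le.
have [gam [/andP[gam_ge gam_le] xkS_min _]] := mpqn_iterate k.
have xk_dom := mpqn_edom k; have [dg _] := g_smooth xk_dom.
eexists.
  exact: (global_min_regular_subdiff f_proper xk_dom (F_split xk_dom) xkS_min
    (ltW mu_gt0) (H_sym _) (dg _)).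
have gam0 : 0 < gam by exact: lt_le_trans gam_ge.
rewrite enormN (le_trans (ler_enormD _ _))// mulrDl lerD ?model_gap_gradient//.
by rewrite enormZ gtr0_norm// -mulrA ler_pM ?enorm_ge0 ?(ltW gam0).
Qed.

Lemma mpqn_value_le M k z : 0 <= M -> opnorm_le (H (x k)) M -> edom f z ->
  fine (f (x k.+1)) <=
  fine (f z) + (L + stepsize_bound * M) * enorm (x k - z) ^+ 2.
Proof.
move=> M0 H_le z_dom.
have [gam [/andP[gam_ge gam_le] xkS_min xkS_acc]] := mpqn_iterate k.
have xk_dom := mpqn_edom k; have gam0 : 0 < gam by exact: lt_le_trans gam_ge.
have := acceptable_min_le f_proper xk_dom (F_split xk_dom) xkS_min z_dom
  xkS_acc.
have decrease_ge0 : 0 <= (1 - delta) *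
    (gam / 2 * mnorm (H (x k)) (x k.+1 - x k) ^+ 2).
  rewrite mulr_ge0 ?subr_ge0 ?(ltW delta_lt1)// mulr_ge0 ?sqr_ge0//.
  by rewrite divr_ge0// ltW.
have /ler_normlP[_ gap_le] := model_gap_le z xk_dom.
have : gam / 2 * mnorm (H (x k)) (z - x k) ^+ 2 <=
    stepsize_bound * M * enorm (z - x k) ^+ 2.
  rewrite -[leRHS]mulrA ler_pM ?divr_ge0 ?sqr_ge0 ?(ltW gam0)//; first by lra.
  by apply: sqr_mnorm_le; rewrite (H_sym _).1.
by rewrite (enormC (x k)); lra.
Qed.

Lemma mpqn_values_cvg M xs : lower_semicontinuous f -> edom f xs -> 0 <= M ->
  (\forall u \near xs, opnorm_le (H u) M) -> cluster (x @ \oo) xs ->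
  fine (f (x k)) @[k --> \oo] --> fine (f xs).
Proof.
move=> f_lsc xs_dom M0 H_le xs_acc.
pose h u := fine (f xs) + (L + stepsize_bound * M) * enorm (u - xs) ^+ 2.
apply: (nonincreasing_values_cvg (h := h) f_lsc _ _ _ xs_acc H_le).
- exact: edom_fin_num.
- by move=> k; exact: edom_fin_num (mpqn_edom k).
- apply: sufficient_decrease_nonincreasing mpqn_sufficient_decrease.
  by rewrite !mulr_gt0// subr_gt0.
- rewrite /h -[X in _ --> X]addr0; apply: (@cvgD _ _ _ (nbhs xs)).
    exact: cvg_cst.
  rewrite -(mulr0 (L + stepsize_bound * M)); apply: (@cvgMr _ _ (nbhs xs)).
  under eq_fun do rewrite expr2.
  rewrite -(mulr0 (0 : R)).
  by apply: (@cvgM _ _ (nbhs xs)); exact: enorm_sub_cvg0.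
- by move=> k xk_le; exact: mpqn_value_le.
Qed.

End ModelProximalQuasiNewton.

Theorem theorem4p11 (R : realType) (n : nat)
    (f : 'rV[R]_n -> \bar R) (F : 'rV[R]_n -> 'rV[R]_n -> \bar R)
    (g : 'rV[R]_n -> 'rV[R]_n -> R) (H : 'rV[R]_n -> 'M[R]_n)
    (tau mu gmin gmax delta L : R)
    (x : nat -> 'rV[R]_n) (xs : 'rV[R]_n)
    (f_proper : proper_fun f) (f_lsc : lower_semicontinuous f)
    (F_model : forall xb, edom f xb -> local_model f xb (F xb))
    (tau_gt1 : 1 < tau) (mu_gt0 : 0 < mu)
    (gmin_gt0 : 0 < gmin) (gmin_le_gmax : gmin <= gmax)
    (delta_gt0 : 0 < delta) (delta_lt : delta < 1 / 2)
    (f_bounded : bounded_below f)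
    (F_minorized : forall xb, edom f xb -> affinely_minorized (F xb))
    (H_sym : forall z, sym_eig_ge mu (H z)) (H_cont : continuous H)
    (x_mpqn : mpqn_sequence f F H tau gmin gmax delta x)
    (xs_acc : cluster (x @ \oo) xs)
    (F_split : forall xb, edom f xb -> forall z, F xb z = ((g xb z)%:E + f z)%E)
    (g_smooth : forall xb, edom f xb -> smooth (g xb))
    (L_gt0 : 0 < L)
    (g_subdiff : forall xb, edom f xb -> forall z,
      subdiff (fun y => (g xb y)%:E) z `<=`
        [set L *: v | v in ecball (enorm (z - xb)) 0])
    (f_KL : KL_property f xs) :
  x @ \oo --> xs /\ stationary f xs.
Proof.
have delta_lt1 : delta < 1 by lra.
have x_dom k : edom f (x k).
  by apply: (mpqn_edom f_proper x_mpqn F_model F_split g_smooth g_subdiff).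
have xs_dom : edom f xs by case: f_KL => _ _ [v []].
have [M M_gt0 H_le] := continuous_near_opnorm_le (H_cont xs).
pose a := (1 - delta) * (gmin / 2 * mu).
pose B := L + stepsize_bound tau mu gmax delta L * M.
apply: (@KL_descent_cvg _ _ f x xs a B [set u | opnorm_le (H u) M]) => //.
- by move=> k; exact: edom_fin_num.
- by rewrite !mulr_gt0 ?subr_gt0.
- rewrite addr_gt0// !mulr_gt0 ?(lt_trans _ tau_gt1)// lt_max.
  by rewrite (lt_le_trans gmin_gt0).
- exact: (mpqn_sufficient_decrease f_proper x_mpqn F_model F_split g_smooth
    g_subdiff H_sym).
- exact: (mpqn_relative_error f_proper x_mpqn F_model F_split g_smooth
    g_subdiff H_sym tau_gt1 mu_gt0 gmin_gt0 delta_gt0 L_gt0 (ltW M_gt0)).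
- exact: (mpqn_values_cvg f_proper x_mpqn F_model F_split g_smooth
    g_subdiff H_sym tau_gt1 mu_gt0 gmin_gt0 delta_gt0 delta_lt1 L_gt0
    f_lsc xs_dom (ltW M_gt0) H_le xs_acc).
Qed.
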